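(* Let $r\geq 3$, let $P$ be an $r$-pattern, and let $v$ be a vertex of $P$ such that some maximal weighting of $P$ assigns $v$ positive weight. Suppose that $\lambda\left(\mathrm{FR}_v(P)\right)=\lambda(P)$ and $r!\,\lambda(P)<1$, and let $\alpha=r!\,\lambda(P)$. Then: (i) if $r=3$, then $\alpha\geq\frac{6}{121}\left(5\sqrt5-2\right)$; and (ii) if $r\geq 4$, then $\alpha\geq\frac{2\,r!}{r^r}$.
   Context: An $r$-pattern $P=(V(P),E(P))$ consists of a finite vertex set $V(P)$ and a set $E(P)$ of edges, each of which is a multiset of size $r$ on $V(P)$. For an edge $e$, $m_e(v)$ denotes the multiplicity of $v$ in $e$. Lagrangian: a weighting $w$ of $V(P)$ assigns to each vertex $v$ a real weight $w(v)\ge 0$ with $\sum_{v}w(v)=1$. Put $w(e)=\prod_{v\in V(P)}\frac{w(v)^{m_e(v)}}{m_e(v)!}$ for each edge $e$, $w(P)=\sum_{e\in E(P)}w(e)$, and $\lambda(P)=\max\{w(P): w \text{ a weighting of } V(P)\}$. A weighting attaining this maximum is called a maximal weighting of $P$. Blow-up: given positive integers $\mathbf{k}=(k_u)_{u\in V(P)}$, the blow-up $P(\mathbf{k})$ is the $r$-pattern with vertex set $\{(u,i):u\in V(P),1\le i\le k_u\}$ in which the multiset $(u_1,i_1)\dots(u_r,i_r)$ is an edge if and only if the multiset $u_1\dots u_r$ is an edge of $P$. Frankl–Rödl construction: for $v\in V(P)$, set $k_v=r$ and $k_u=1$ for all other vertices $u$. Let $P'$ be the $r$-pattern on the vertex set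 of $P(\mathbf{k})$ with edge set $E(P')=\{e\in E(P(\mathbf{k})): m_e((v,i))\le 1 \text{ for all } i\in\{2,\dots,r\}\}$. Then $\mathrm{FR}_v(P)$ is the $r$-pattern obtained from $P'$ by adding the single edge $\{(v,1),(v,2),\dots,(v,r)\}$. *)

(* Defs.v *)
From HB Require Import structures.
From mathcomp Require Import all_boot all_order all_algebra.
From mathcomp Require Import finmap multiset.
From mathcomp Require Import all_classical all_reals all_analysis.

Set Implicit Arguments.
Unset Strict Implicit.
Unset Printing Implicit Defensive.

Import Order.TTheory GRing.Theory Num.Theory.
Import numFieldNormedType.Exports.

Local Open Scope mset_scope.

(* For e : {mset V}, [e u] is the multiplicity of u in e and [size e] counts
   elements with multiplicity. *)
Record pattern (r : nat) := Pattern {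
  vertex :> finType;
  edges : {fset {mset vertex}};
  edges_size : forall e : {mset vertex}, e \in edges -> size e = r
}.

Section Lagrangian.
Local Open Scope ring_scope.
Local Open Scope classical_set_scope.
Context {R : realType} {r : nat}.
Implicit Type P : pattern r.

Definition is_weighting (V : finType) (w : V -> R) : Prop :=
  (forall u, 0 <= w u) /\ \sum_u w u = 1.

Definition edge_weight (V : finType) (w : V -> R) (e : {mset V}) : R :=
  \prod_u (w u ^+ e u / (e u)`!%:R).

Definition weight P (w : P -> R) : R := \sum_(e <- edges P) edge_weight w e.

(* The supremum is attained as soon as P has a vertex, see
   [maximal_weighting_exists] and [weight_le_lagrangian]. *)
Definition lagrangian P : R :=
  sup [set weight w | w in [set w : P -> R | is_weighting w]].

Definition maximal_weighting P (w : P -> R) : Prop :=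
  is_weighting w /\ weight w = lagrangian P.

End Lagrangian.
Arguments weight {R r} P w.
Arguments lagrangian R {r} P.
Arguments maximal_weighting {R r} P w.

Section BlowUp.
Context {r : nat} (P : pattern r).

(* The vertex (u, i), 1 <= i <= k u, is encoded as [Tagged _ j] with tag u and
   j : 'I_(k u) equal to i - 1. *)
Definition blowup_vertex (k : P -> nat) : finType := {u : P & 'I_(k u)}.

Definition blowup_edges (k : P -> nat) : {fset {mset blowup_vertex k}} :=
  [fset seq_mset (tval t) | t in [pred t : r.-tuple (blowup_vertex k) |
     seq_mset (map tag t) \in edges P]]%fset.

Lemma in_blowup_edges k (t : r.-tuple (blowup_vertex k)) :
  (seq_mset t \in blowup_edges k) = (seq_mset (map tag t) \in edges P).
Proof.
apply/imfsetP/idP => [[t' /= t'P /eq_seq_msetP tt']|tP]; last by exists t.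
by rewrite (_ : seq_mset _ = seq_mset (map tag t')) //; apply/eq_seq_msetP/perm_map.
Qed.

Lemma blowup_edges_size k (e : {mset blowup_vertex k}) : e \in blowup_edges k -> size e = r.
Proof.
by case/imfsetP => t _ ->; rewrite (perm_size (perm_eq_seq_mset _)) size_tuple.
Qed.

Definition blowup (k : P -> nat) : pattern r :=
  Pattern (@blowup_edges_size k).

Variable v : P.

Definition FR_mult (u : P) : nat := if u == v then r else 1.

(* [0 < tagged x] says that the copy x = (v, i) has i >= 2. *)
Definition FR_old_edges : {fset {mset blowup FR_mult}} :=
  [fset e in edges (blowup FR_mult) |
     [forall x : blowup FR_mult,
        (tag x == v) && (0 < tagged x) ==> (e x <= 1)]]%fset.

(* {(v,1), ..., (v,r)} *)
Definition FR_new_edge : {mset blowup FR_mult} :=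
  seq_mset (enum [pred x : blowup FR_mult | tag x == v]).

Definition FR_edges : {fset {mset blowup FR_mult}} :=
  (FR_new_edge |` FR_old_edges)%fset.

Lemma FR_edges_size (e : {mset blowup FR_mult}) : e \in FR_edges -> size e = r.
Proof.
case/fset1UP => [->|]; last first.
  by rewrite !inE /= => /andP[/blowup_edges_size].
rewrite (perm_size (perm_eq_seq_mset _)) -cardE -sum1_card.
rewrite (eq_bigl (fun x : blowup FR_mult => (tag x == v) && true)); last first.
  by move=> x; rewrite inE andbT.
rewrite -(sig_big_dep (fun u => u == v) (fun _ _ => true) (fun _ _ => 1)) /=.
by rewrite big_pred1_eq sum1_card card_ord /FR_mult eqxx.
Qed.

Definition FR : pattern r := Pattern FR_edges_size.

End BlowUp.

Section LagrangianMax.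
Local Open Scope ring_scope.
Local Open Scope classical_set_scope.
Context {R : realType} {r : nat} (P : pattern r).

Lemma is_weighting_le1 (w : P -> R) u : is_weighting w -> w u <= 1.
Proof.
by case=> w0 <-; rewrite (bigD1 u) //= lerDl; apply: sumr_ge0.
Qed.

Lemma maximizer_exists (v : P) : exists2 w : P -> R, is_weighting w &
  forall w', is_weighting w' -> weight P w' <= weight P w.
Proof.
pose X := prod_topology (fun _ : P => R).
pose A : set X := [set w | is_weighting (w : P -> R)].
have projC (u : P) : continuous (fun w : X => w u : R).
  exact: (@proj_continuous P (fun=> R) u).
have sumC : continuous (fun w : X => \sum_u (w u : R)).
  apply: (@continuous_big R P +%R 0 xpredT (@add_continuous R) X
    (index_enum P) (fun u w => w u)) => u _.
  exact: projC.
have cA : compact A.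
  have cK : compact [set w : X | forall u, `[0, 1]%classic (w u)].
    by apply: (@tychonoff P (fun=> R) (fun=> `[0, 1]%classic)) => u; exact: segment_compact.
  have AK : A `<=` [set w : X | forall u, `[0, 1]%classic (w u)].
    move=> w Aw u /=; rewrite in_itv /= (proj1 Aw) /=.
    exact: (is_weighting_le1 u Aw).
  suff cl : closed A by exact: (subclosed_compact cl cK AK).
  have -> : A = (\bigcap_u [set w : X | 0 <= (w u : R)]) `&`
                [set w : X | \sum_u (w u : R) = 1].
    apply/seteqP; split => w [w0 w1]; split => //; first by move=> u _; exact: w0.
    by move=> u; exact: w0.
  apply: closedI.
    apply: closed_bigI => u _.
    apply: (@preimage_closed X R (fun w : X => w u : R) [set x : R | 0 <= x]).
      by move=> w _; exact: projC.
    exact: closed_ge.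
  apply: (@preimage_closed X R (fun w : X => \sum_u (w u : R)) [set x : R | x = 1]).
    by move=> w _; exact: sumC.
  exact: closed_eq.
have wC : continuous (fun w : X => weight P (w : P -> R)).
  apply: (@continuous_big R _ +%R 0 xpredT (@add_continuous R) X
    (edges P) (fun e (w : X) => edge_weight (w : P -> R) e)) => e _.
  apply: (@continuous_big R P *%R 1 xpredT (@mul_continuous R) X
    (index_enum P) (fun u w => w u ^+ e u / (e u)`!%:R)) => u _ w.
  apply: (@cvgMl R X (nbhs w) _ (fun w : X => (w u : R) ^+ e u)).
  apply: (@continuous_comp X R R (fun w : X => w u : R) (fun x => x ^+ e u)).
    exact: projC.
  exact: exprn_continuous.
have A0 : A !=set0.
  exists (fun u => (u == v)%:R); split => [u|]; first by rewrite ler0n.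
  by rewrite (bigD1 v) //= eqxx big1 ?addr0 // => u /negPf ->.
have [w wA wmax] := compact_EVT_max A0 cA (continuous_subspaceT wC).
by exists w => [|w' w'A]; [exact/set_mem | exact/wmax/mem_set].
Qed.

Lemma weight_le_lagrangian (w : P -> R) :
  is_weighting w -> weight P w <= lagrangian R P.
Proof.
move=> ww.
have [v _|P0] := pickP (fun _ : P => true); last first.
  case: ww => _; rewrite big1; first by move/eqP; rewrite eq_sym oner_eq0.
  by move=> u; have := P0 u.
have [w1 _ w1max] := maximizer_exists v.
apply: ub_le_sup; last by exists w.
by exists (weight P w1) => _ [w' ww' <-]; exact: w1max.
Qed.

Lemma maximal_weighting_exists (v : P) :
  exists w : P -> R, maximal_weighting P w.
Proof.
have [w ww wmax] := maximizer_exists v.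
exists w; split => //; apply/eqP; rewrite eq_le weight_le_lagrangian //=.
apply: ge_sup; first by exists (weight P w), w.
by move=> _ [w' ww' <-]; exact: wmax.
Qed.

End LagrangianMax.

(* Main.v *)
(** If every edge of P had multiplicity at most 1 at v, splitting the weight of v
    equally among its r copies would lose nothing, and the new edge would make
    lambda(FR_v(P)) > lambda(P).  So some edge e has multiplicity at least 2 at v.
    Weighting each vertex by m_e / r gives lambda(P) >= r^-r prod m^m / m! >= 2 / r^r.
    For r = 3 either e = vvv, and then r! lambda(P) >= 1, or e = vvu, and then
    lambda(P) = lambda(FR_v(P)) >= lambda(FR_v({vvu})) = (5 sqrt 5 - 2) / 121. *)
Require Import Defs.
From mathcomp Require Import all_boot all_order all_algebra all_reals.
From mathcomp Require Import finmap multiset ring lra.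

Set Implicit Arguments.
Unset Strict Implicit.
Unset Printing Implicit Defensive.

Import Order.TTheory GRing.Theory Num.Theory.

Local Open Scope ring_scope.

(** * Edge weights of multisets listed as sequences *)

Section EdgeWeight.
Context {R : realType} {V : finType}.
Implicit Types (w : V -> R) (s : seq V).

Lemma edge_weight_ge0 w (e : {mset V}%mset) :
  (forall u, 0 <= w u) -> 0 <= edge_weight w e.
Proof. by move=> w0; apply: prodr_ge0 => u _; rewrite divr_ge0 ?exprn_ge0. Qed.

Lemma edge_weight_seq w s :
  edge_weight w (seq_mset s) =
    (\prod_(x <- s) w x) / \prod_u (count_mem u s)`!%:R.
Proof.
rewrite /edge_weight prodf_div; congr (_ / _); last first.
  by apply: eq_bigr => u _; rewrite mset_seqE.
elim: s => [|x s IHs]; first by rewrite big_nil big1 // => u _; rewrite mset_seqE.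
rewrite big_cons -IHs.
under eq_bigr do rewrite mset_seqE /= exprD.
rewrite big_split; congr (_ * _); last by apply: eq_bigr => u _; rewrite mset_seqE.
by rewrite (bigD1 x) //= eqxx expr1 big1 ?mulr1 // => u; rewrite eq_sym => /negPf ->.
Qed.

Lemma edge_weight_uniq w s :
  uniq s -> edge_weight w (seq_mset s) = \prod_(x <- s) w x.
Proof.
move=> us; rewrite edge_weight_seq [X in _ / X]big1 ?divr1 // => u _.
by rewrite count_uniq_mem //; case: (_ \in _).
Qed.

Lemma edge_weight_double w a u :
  a != u -> edge_weight w (seq_mset [:: a; a; u]) = w a ^+ 2 * w u / 2.
Proof.
move=> au; rewrite edge_weight_seq !big_cons big_nil mulr1 mulrA -expr2.
congr (_ / _); rewrite (bigD1 a) //= big1.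
  by rewrite eqxx eq_sym (negPf au) mulr1.
by move=> x xa; rewrite eq_sym (negPf xa); case: (_ == _).
Qed.

End EdgeWeight.

(** Vertices outside the image of [h] have multiplicity 0 and contribute only [0! = 1]. *)
Lemma edge_weight_map (R : realType) (V W : finType) (h : V -> W) (w : W -> R)
    (s : seq V) :
  injective h ->
  edge_weight w (seq_mset (map h s)) = edge_weight (w \o h) (seq_mset s).
Proof.
move=> hI; rewrite !edge_weight_seq big_map; congr (_ / _).
rewrite (bigID (mem (codom h))) /= [X in _ * X]big1 ?mulr1; last first.
  move=> x xh; rewrite (count_memPn _) //.
  by apply: contra xh => /mapP[u _ ->]; exact: codom_f.
rewrite -big_uniq /=; last by rewrite /codom /image_mem map_inj_uniq ?enum_uniq.
rewrite big_map big_enum; apply: eq_bigr => u _.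
by rewrite count_map; congr (_`!%:R); apply: eq_count => x /=; rewrite (inj_eq hI).
Qed.

(** * Lower bounds on weights and Lagrangians *)

Section WeightBounds.
Context {R : realType} {r : nat}.
Implicit Type P : pattern r.

(** The omitted edges have nonnegative weight, so exhibiting some distinct edges already bounds the
    weight from below. *)
Lemma weight_ge_sub P (w : P -> R) (s : seq {mset P}%mset) :
  (forall u, 0 <= w u) -> uniq s -> {subset s <= edges P} ->
  \sum_(e <- s) edge_weight w e <= weight P w.
Proof.
move=> w0 us sP; rewrite /weight [leRHS](bigID (mem s)) /=.
have <- : \sum_(e <- s) edge_weight w e = \sum_(e <- edges P | e \in s) edge_weight w e.
  rewrite -[RHS]big_filter; apply: perm_big; apply: uniq_perm => //.
    by rewrite filter_uniq // fset_uniq.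
  by move=> e; rewrite mem_filter; case: (boolP (e \in s)) => //= /sP.
by rewrite lerDl sumr_ge0 // => e _; exact: edge_weight_ge0.
Qed.

Lemma sum_mult (V : finType) (e : {mset V}%mset) : (\sum_u e u = size e)%N.
Proof.
under eq_bigr do rewrite -count_mem_mset -sum1_count.
rewrite (exchange_big_dep xpredT) //= -sum1_size.
by apply: eq_bigr => x _; rewrite (big_pred1 x).
Qed.

Lemma expn_self_ge_fact m : (m`! <= m ^ m)%N.
Proof.
elim: m => // m IHm; rewrite factS expnS leq_mul // (leq_trans IHm) //.
by case: m {IHm} => // m; rewrite leq_exp2r.
Qed.

(** Source of the factor 2 in the bound for r >= 4, with m the multiplicity of v. The induction
    starts from equality at m = 2. *)
Lemma double_fact_le_expn_self m : (1 < m)%N -> (2 * m`! <= m ^ m)%N.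
Proof.
elim: m => // -[|[|m]] // IHm _; rewrite factS expnS mulnCA leq_mul //.
by rewrite (leq_trans (IHm isT)) // leq_exp2r.
Qed.

(* The weighting proportional to the multiplicities in e makes every factor
   equal to (m / r)^m / m!, and m^m >= m!. *)
Lemma lagrangian_ge_edge P (e : {mset P}%mset) (v : P) :
  (0 < r)%N -> e \in edges P ->
  (e v ^ e v)%N%:R / (e v)`!%:R / r%:R ^+ r <= lagrangian R P.
Proof.
move=> r0 eP; have sz := edges_size eP.
pose w (u : P) : R := (e u)%:R / r%:R.
have ww : is_weighting w.
  split=> [u|]; first by rewrite divr_ge0 ?ler0n.
  by rewrite -mulr_suml -natr_sum sum_mult sz divff // pnatr_eq0 -lt0n.
apply: le_trans (weight_le_lagrangian ww).
apply: (@le_trans _ _ (edge_weight w e)); last first.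
  have := @weight_ge_sub P w [:: e] (proj1 ww) isT; rewrite big_seq1; apply.
  by move=> f; rewrite inE => /eqP ->.
have -> : edge_weight w e = \prod_u ((e u ^ e u)%N%:R / (e u)`!%:R) / r%:R ^+ r.
  have <- : \prod_u r%:R ^+ e u = r%:R ^+ r :> R by rewrite prodrXr sum_mult sz.
  rewrite -prodf_div; apply: eq_bigr => u _.
  by rewrite expr_div_n natrX mulrAC.
rewrite ler_pM2r ?invr_gt0 ?exprn_gt0 ?ltr0n // (bigD1 v) //=.
rewrite ler_peMr ?divr_ge0 ?ler0n //.
elim/big_ind: _ => // [x y x1 y1|u _].
  by rewrite -[leLHS]mulr1 ler_pM.
by rewrite ler_pdivlMr ?ltr0n ?fact_gt0 // mul1r ler_nat expn_self_ge_fact.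
Qed.

End WeightBounds.

(** * Vertices, edges and weightings of the Frankl-Rödl pattern *)

Section FRConstruction.
Context {R : realType} {r : nat} (P : pattern r) (v : P) (r_gt0 : (0 < r)%N).

Let FR_mult_gt0 (u : P) : (0 < FR_mult v u)%N.
Proof. by rewrite /FR_mult; case: (u == v). Qed.

(* (u, 1) if u <> v and (v, i + 1) if u = v, thanks to the remainder. *)
Definition FR_copy (i : nat) (u : P) : FR v :=
  Tagged (fun u => 'I_(FR_mult v u)) (Ordinal (ltn_pmod i (FR_mult_gt0 u))).

Lemma FR_copy_inj i : injective (FR_copy i).
Proof. by move=> u u' /(congr1 tag). Qed.

Lemma map_tag_FR_copy i s : map tag (map (FR_copy i) s) = s.
Proof. by rewrite -map_comp map_id_in. Qed.

Lemma tagged_FR_copy i : (i < r)%N -> tagged (FR_copy i v) = i :> nat.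
Proof. by move=> ir; rewrite /= /FR_mult eqxx modn_small. Qed.

Lemma eq_FR_copy i j : (i < r)%N -> (j < r)%N ->
  (FR_copy i v == FR_copy j v) = (i == j).
Proof.
move=> ir jr; apply/eqP/eqP => [e|-> //].
by rewrite -(tagged_FR_copy ir) e tagged_FR_copy.
Qed.

Lemma eq_FR_copy_neq i j u u' : u != u' -> (FR_copy i u == FR_copy j u') = false.
Proof. by move=> uu'; apply/negP => /eqP/(congr1 tag)/= e; rewrite e eqxx in uu'. Qed.

Lemma FR_old_edge (s : seq (FR v)) :
  seq_mset (map tag s) \in edges P ->
  (forall x : FR v, tag x = v -> (0 < tagged x)%N -> (count_mem x s <= 1)%N) ->
  seq_mset s \in edges (FR v).
Proof.
move=> sP s1.
have sz : size s == r.
  by have := edges_size sP; rewrite (perm_size (perm_eq_seq_mset _)) size_map => /eqP.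
apply/fset1UP; right; rewrite inE; apply/andP; split => /=.
  by rewrite (in_blowup_edges (Tuple sz)).
by apply/forallP => x; apply/implyP => /andP[/eqP xv x0]; rewrite mset_seqE s1.
Qed.

Lemma FR_new_edge_in : FR_new_edge v \in edges (FR v).
Proof. by apply/fset1UP; left. Qed.

Lemma FR_new_edgeE (x : FR v) : FR_new_edge v x = (tag x == v).
Proof. by rewrite mset_seqE count_uniq_mem ?enum_uniq // mem_enum inE. Qed.

(** [g i] is the weight of the copy (v, i + 1), so the copies of v may be weighted unequally. *)
Definition FR_weighting (w : P -> R) (g : nat -> R) (x : FR v) : R :=
  if tag x == v then g (tagged x) else w (tag x).

Lemma FR_weighting_copy w g i u : (i < r)%N ->
  FR_weighting w g (FR_copy i u) = if u == v then g i else w u.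
Proof.
rewrite /FR_weighting /= => ir; case: eqP => // ->.
by rewrite /FR_mult eqxx modn_small.
Qed.

Lemma is_weighting_FR (w : P -> R) (g : nat -> R) :
  (forall u, 0 <= w u) -> (forall i, 0 <= g i) ->
  \sum_(i < r) g i + \sum_(u | u != v) w u = 1 -> is_weighting (FR_weighting w g).
Proof.
move=> w0 g0 sum1; split=> [x|]; first by rewrite /FR_weighting; case: ifP.
rewrite -sum1 /FR_weighting.
rewrite (eq_bigl (fun x : FR v => true && true)) //.
pose F u (j : 'I_(FR_mult v u)) := if u == v then g j else w u.
rewrite -(sig_big_dep xpredT (fun _ _ => true) F) (bigD1 v) //= {}/F eqxx.
congr (_ + _); first by rewrite /FR_mult eqxx.
apply: eq_bigr => u /negPf uv.
by rewrite uv sumr_const card_ord /FR_mult uv.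
Qed.

Lemma edge_weight_FR_new_edge (w : P -> R) (g : nat -> R) :
  edge_weight (FR_weighting w g) (FR_new_edge v) = \prod_(i < r) g i.
Proof.
rewrite edge_weight_uniq ?enum_uniq // big_enum /= /FR_weighting.
rewrite (eq_bigl (fun x : FR v => (tag x == v) && true)); last first.
  by move=> x; rewrite inE andbT.
pose F u (j : 'I_(FR_mult v u)) := if u == v then g j else w u.
rewrite -(sig_big_dep (fun u => u == v) (fun _ _ => true) F) big_pred1_eq {}/F eqxx.
by rewrite /FR_mult eqxx.
Qed.

End FRConstruction.

(** * Patterns all of whose edges are simple at v *)

Lemma edge_weight_scale (R : realType) (V : finType) (v : V) (c : R) (w : V -> R)
    (e : {mset V}%mset) :
  edge_weight (fun u => if u == v then c * w u else w u) e = c ^+ e v * edge_weight w e.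
Proof.
rewrite /edge_weight (bigD1 v) //= [in RHS](bigD1 v) //= eqxx exprMn -!mulrA.
by do 3!congr (_ * _); apply: eq_bigr => u /negPf ->.
Qed.

(* Split the weight of v equally among its r copies: an edge through v, being
   simple at v, is shared out among its r lifts, all of which are kept in FR v,
   so that the new edge is a net gain. *)
Lemma lagrangian_FR_simple (R : realType) (r : nat) (P : pattern r) (v : P)
    (w : P -> R) :
  (1 < r)%N -> {in edges P, forall e : {mset P}%mset, (e v <= 1)%N} -> is_weighting w ->
  weight P w + (w v / r%:R) ^+ r <= lagrangian R (FR v).
Proof.
move=> r1 P1 [w0 w1]; have r0 := ltnW r1.
have rR0 : r%:R != 0 :> R by rewrite pnatr_eq0 -lt0n.
pose g (_ : nat) := w v / r%:R.
have g0 i : 0 <= g i by rewrite divr_ge0 ?ler0n.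
pose W := @FR_weighting R r P v w g.
have WW : is_weighting W.
  apply: is_weighting_FR => //; rewrite /g sumr_const card_ord.
  rewrite -[_ / _ *+ _]mulr_natr divfK //.
  by rewrite -w1 [in RHS](bigD1 v).
apply: le_trans (weight_le_lagrangian WW).
(* [lift e i] puts the copy (v, i + 1) in place of v. If v is not in [e], all lifts coincide, hence
   the single index 0 in [L e]. *)
pose lift (e : {mset P}%mset) i : {mset FR v}%mset := seq_mset (map (FR_copy v r0 i) e).
pose L (e : {mset P}%mset) := if e v == 1%N then iota 0 r else [:: 0%N].
have Lr e i : i \in L e -> (i < r)%N.
  by rewrite /L; case: ifP => _; rewrite ?mem_iota ?inE // => /eqP ->.
pose S := [seq lift e i | e <- edges P, i <- L e].
have liftE e i : (i < r)%N -> edge_weight W (lift e i) = r%:R^-1 ^+ e v * edge_weight w e.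
  move=> ir; rewrite edge_weight_map; last exact: FR_copy_inj.
  rewrite seq_mset_id -edge_weight_scale; apply: eq_bigr => u _.
  by rewrite /W /comp FR_weighting_copy //; case: eqP => // ->; rewrite /g [w v / _]mulrC.
have lift_tag e i x :
    (lift e i) x = (if x == FR_copy v r0 i (tag x) then e (tag x) else 0)%N.
  rewrite mset_seqE; case: eqP => [{1}->|xi].
    by rewrite count_map -count_mem_mset; apply: eq_count => u /=;
       rewrite (inj_eq (@FR_copy_inj _ _ _ _ _)).
  by apply/count_memPn/mapP => -[u _ xu]; apply: xi; rewrite {2}xu.
have lift_inj (e e' : {mset P}%mset) i j : lift e i = lift e' j -> e = e'.
  move=> eqL; rewrite -[e]seq_mset_id -[e']seq_mset_id; apply/eq_seq_msetP.
  rewrite -(map_tag_FR_copy v r0 i e) -(map_tag_FR_copy v r0 j e').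
  by apply: perm_map; apply/eq_seq_msetP.
have uS : uniq (FR_new_edge v :: S).
  apply/andP; split.
    (* The new edge contains all r > 1 copies of v, a lift at most one. *)
    apply/negP => /allpairsPdep[e [i [_ iL newE]]].
    have new_i j : (j < r)%N -> j = i.
      move=> jr; apply/eqP; rewrite -(eq_FR_copy v r0 jr (Lr _ _ iL)).
      move: (FR_new_edgeE (FR_copy v r0 j v)); rewrite newE lift_tag /=.
      by case: eqP => //; rewrite eqxx.
    by have := new_i 1%N r1; rewrite -(new_i 0%N r0).
  apply: allpairs_uniq_dep => [|e _|]; first exact: fset_uniq.
    by rewrite /L; case: ifP => _; rewrite ?iota_uniq.
  move=> _ _ /allpairsPdep[e [i [_ iL ->]]] /allpairsPdep[e' [j [_ jL ->]]] /= eqL.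
  have ee := lift_inj _ _ _ _ eqL; subst e'; congr Tagged; apply/eqP.
  (* When [e v = 1], the multiplicity at the copy (v, i + 1) tells the lifts of [e] apart. *)
  have := congr1 (fun f : {mset FR v}%mset => f (FR_copy v r0 i v)) eqL.
  have [ir jr] := (Lr _ _ iL, Lr _ _ jL); move: iL jL; rewrite /L.
  case: eqP => [ev1 _ _|_]; last by rewrite !inE => /eqP -> /eqP ->.
  by rewrite !lift_tag /= eqxx ev1 eq_FR_copy //; case: eqP.
have sS : {subset FR_new_edge v :: S <= edges (FR v)}.
  move=> f; rewrite inE => /predU1P[->|]; first exact: FR_new_edge_in.
  case/allpairsPdep => e [i [eP iL ->]]; apply: FR_old_edge.
    by rewrite map_tag_FR_copy seq_mset_id.
  move=> x xv _; rewrite -mset_seqE lift_tag; case: ifP => // _.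
  by rewrite xv P1.
apply: le_trans (weight_ge_sub (proj1 WW) uS sS).
rewrite big_cons edge_weight_FR_new_edge prodr_const card_ord addrC lerD2l.
(* Equality holds edge by edge: r lifts of weight w(e) / r if v is in [e], one lift of weight w(e)
   otherwise. *)
rewrite big_allpairs_dep le_eqVlt; apply/orP; left; apply/eqP.
rewrite /weight big_seq [RHS]big_seq; apply: eq_bigr => e eP.
rewrite big_seq (eq_bigr (fun=> r%:R^-1 ^+ e v * edge_weight w e)); last first.
  by move=> i /Lr; exact: liftE.
rewrite -big_seq big_const_seq count_predT iter_addr_0 /L.
case: eqP => [->|]; first by rewrite size_iota expr1 -mulrnAl -mulr_natr mulVf ?mul1r.
by have := P1 _ eP; case: (e v) => [|[]] // _ _; rewrite mulr1n expr0 mul1r.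
Qed.

(** * Edges with a double vertex when r = 3 *)

(** The copies of v weigh a, y, y and u weighs b. The lifts of vvu used are the one doubling (v, 1)
    and the three with two different copies; a y^2 comes from the new edge. *)
Lemma lagrangian_FR_double (R : realType) (P : pattern 3) (u v : P) (a y b : R) :
  v != u -> seq_mset [:: v; v; u] \in edges P ->
  0 <= a -> 0 <= y -> 0 <= b -> a + 2 * y + b = 1 ->
  b * (a ^+ 2 / 2 + 2 * a * y + y ^+ 2) + a * y ^+ 2 <= lagrangian R (FR v).
Proof.
move=> vu eP a0 y0 b0 sum1.
have uv : u == v = false by rewrite eq_sym (negPf vu).
pose w x := if x == u then b else 0.
pose g i := nth 0 [:: a; y; y] i.
pose W := @FR_weighting R 3 P v w g.
have WW : is_weighting W.
  apply: is_weighting_FR.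
  - by move=> x; rewrite /w; case: ifP.
  - by move=> [|[|[|i]]] //=; rewrite /g /= nth_nil.
  rewrite !big_ord_recl big_ord0 (bigD1 u) /= ?uv // big1 => [|x /andP[_ /negPf xu]].
    by rewrite /g /= /w eqxx -sum1; ring.
  by rewrite /w xu.
apply: le_trans (weight_le_lagrangian WW).
pose c (i : nat) : FR v := FR_copy v (isT : (0 < 3)%N) i v.
pose d : FR v := FR_copy v (isT : (0 < 3)%N) 0 u.
have cd i : (c i == d) = false by apply: eq_FR_copy_neq.
have dc i : (d == c i) = false by rewrite eq_sym.
have cc i j : (i < 3)%N -> (j < 3)%N -> (c i == c j) = (i == j) by exact: eq_FR_copy.
have Wc i : (i < 3)%N -> W (c i) = g i by move=> i3; rewrite /W FR_weighting_copy // eqxx.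
have Wd : W d = b by rewrite /W FR_weighting_copy // uv /w eqxx.
pose S : seq {mset FR v}%mset := [:: FR_new_edge v; seq_mset [:: c 0%N; c 0%N; d];
  seq_mset [:: c 0%N; c 1%N; d]; seq_mset [:: c 0%N; c 2; d];
  seq_mset [:: c 1%N; c 2; d]].
have uS : uniq S.
  (* The multiplicities at u, (v, 1) and (v, 2) tell the five edges apart. *)
  pose f (e : {mset FR v}%mset) := (e d, e (c 0%N), e (c 1%N)).
  apply: (@map_uniq _ _ f).
  by rewrite /= /f !FR_new_edgeE !mset_seqE /= !cc // !cd !dc /= !eqxx uv.
have old i j : (i < 3)%N -> (j < 3)%N -> (i == j) ==> (i == 0)%N ->
    seq_mset [:: c i; c j; d] \in edges (FR v).
  move=> i3 j3 ij; apply: FR_old_edge => // x xv x0 /=.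
  have -> : d == x = false by apply/negP => /eqP dx; rewrite -xv -dx eqxx in vu.
  case: (eqVneq (c i) x) => // ix; case: (eqVneq (c j) x) => // jx.
  have eij : i == j by rewrite -cc // ix jx.
  by move: ij x0; rewrite eij -ix tagged_FR_copy // => /eqP ->.
have sS : {subset S <= edges (FR v)}.
  apply/allP; rewrite /= FR_new_edge_in /= !old //.
apply: le_trans (weight_ge_sub (proj1 WW) uS sS).
rewrite !big_cons big_nil edge_weight_FR_new_edge edge_weight_double; last by rewrite cd.
rewrite !edge_weight_uniq /= ?inE ?cd ?cc //.
rewrite !big_cons !big_nil !big_ord_recl big_ord0 !Wc // Wd /g /=.
by rewrite le_eqVlt; apply/orP; left; apply/eqP; field.
Qed.

(* d is the critical point of (1 + d)^2 (1 - d) / 16 + d^3 / 27, the best weight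
   when the three copies of v weigh (1 + d) / 2 in total. *)
Lemma lagrangian_FR_double_ge (R : realType) (P : pattern 3) (u v : P) :
  v != u -> seq_mset [:: v; v; u] \in edges P ->
  (5 * Num.sqrt 5 - 2) / 121 <= lagrangian R (FR v).
Proof.
move=> vu eP; have : 0 <= Num.sqrt 5 :> R := sqrtr_ge0 _.
have : Num.sqrt 5 ^+ 2 = 5 :> R by rewrite sqr_sqrtr ?ler0n.
move: (Num.sqrt 5) => q q5 q0; pose d : R := (6 * q - 9) / 11.
(* With b = (1 - d) / 2 fixed, the part of the weight depending on y is y^2 (d - 2 y), largest at y
   = d / 3. *)
have H := @lagrangian_FR_double R P u v (1 / 2 - d / 6) (d / 3) ((1 - d) / 2) vu eP.
move: (lagrangian R (FR v)) H => l {vu eP v u P}.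
(* 2 <= q <= 3 puts d between 0 and 1, so the weights are nonnegative; q^2 = 5 and q^3 = 5 q make
   the final inequality linear in q. *)
have q2 : 2 <= q by rewrite -(@ler_pXn2r _ 2) ?nnegrE ?ler0n // q5; lra.
have q3 : q <= 3 by rewrite -(@ler_pXn2r _ 2) ?nnegrE ?ler0n // q5; lra.
have qqq : q ^+ 3 = 5 * q by rewrite exprS q5 mulrC.
move=> H; apply: le_trans (H _ _ _ _); rewrite /d; clear H d; lra.
Qed.

(** Removing v twice leaves one element u, possibly v itself; this yields the cases vvv and vvu. *)
Lemma mset_count2 (V : finType) (e : {mset V}%mset) (v : V) :
  size e = 3%N -> (1 < e v)%N -> exists u, e = seq_mset [:: v; v; u].
Proof.
rewrite -count_mem_mset -{3}[e]seq_mset_id; move: (e : seq V) => s s3 cv.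
have vs : v \in s by rewrite -has_pred1 has_count ltnW.
have p1 := perm_to_rem vs.
have vs' : v \in rem v s.
  by rewrite -has_pred1 has_count; move: cv; rewrite (permP p1) /= eqxx.
have p2 := perm_to_rem vs'.
have : size (rem v (rem v s)) = 1%N by rewrite !size_rem // s3.
case E : (rem _ (rem _ _)) => [|u []] // _; exists u; apply/eq_seq_msetP.
by rewrite (perm_trans p1) // perm_cons (perm_trans p2) // E.
Qed.

Theorem theorem4p3 (R : realType) (r : nat) (P : pattern r) (v : P)
    (hr : (3 <= r)%N)
    (hv : exists2 w : P -> R, maximal_weighting P w & 0 < w v)
    (hFR : lagrangian R (FR v) = lagrangian R P)
    (hlt : r`!%:R * lagrangian R P < 1) :
  let alpha := r`!%:R * lagrangian R P in
  (r = 3%N -> 6 / 121 * (5 * Num.sqrt 5 - 2) <= alpha) /\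
  ((4 <= r)%N -> 2 * r`!%:R / r%:R ^+ r <= alpha).
Proof.
have r0 : (0 < r)%N by apply: leq_trans hr.
have [e eP ev] : exists2 e : {mset P}%mset, e \in edges P & (1 < e v)%N.
  have [/hasP[e eP ev]|/hasPn P1] :=
    boolP (has (fun e : {mset P}%mset => 1 < e v)%N (edges P)).
    by exists e.
  have [w [ww wE] wv] := hv.
  have P1' : {in edges P, forall e : {mset P}%mset, (e v <= 1)%N}.
    by move=> e /P1; rewrite -leqNgt.
  (* For a maximal [w] this reads lambda(P) + (w v / r)^r <= lambda(P), impossible as [w v > 0]. *)
  have := lagrangian_FR_simple (ltnW hr) P1' ww.
  by rewrite hFR wE gerDl leNgt exprn_gt0 // divr_gt0 ?ltr0n.
have lb := @lagrangian_ge_edge R r P e v r0 eP.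
split=> [r3|r4].
  subst r; have [u eE] := mset_count2 (edges_size eP) ev.
  case: (eqVneq v u) => [vu|vu].
    have ev3 : e v = 3%N by rewrite eE -vu mset_seqE /= eqxx.
    (* For e = vvv the bound is 3^3 / 3! / 3^3 = 1 / 3!, which contradicts [hlt]. *)
    move: lb hlt; rewrite ev3 -!natrX /= => lb; rewrite ltNge; case/negP.
    rewrite -ler_pdivrMl ?ltr0n ?fact_gt0 //; apply: le_trans lb.
    by rewrite !factS fact0 /=; lra.
  rewrite eE in eP; have := lagrangian_FR_double_ge R vu eP; rewrite hFR.
  rewrite -(ler_pM2l (_ : 0 < (3`!)%:R)) ?ltr0n ?fact_gt0 //; apply: le_trans.
  by rewrite mulrAC mulrA.
rewrite mulrAC mulrC ler_pM2l ?ltr0n ?fact_gt0 //; apply: le_trans lb.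
rewrite ler_pM2r ?invr_gt0 ?exprn_gt0 ?ltr0n // ler_pdivlMr ?ltr0n ?fact_gt0 //.
by rewrite -natrM ler_nat double_fact_le_expn_self.
Qed.
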